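(* Let $s,t\ge2$. Let $X$ and $Y$ be the multisets of rows of two disjoint $\mathrm{OA}(\ell,r,s,t)_\lambda$ (on the same set of $s$ distinct rational symbols). Then $(X,Y)$ is a proper $\mathrm{PTE}_r$ solution of degree $t$ and size $\ell$.
   Context: An orthogonal array $\mathrm{OA}(\ell,r,s,t)_\lambda$ of strength $t$, index $\lambda$ and $s$ levels is an $\ell\times r$ array with entries from a set of $s$ symbols (here distinct rational numbers) such that in every $\ell\times t$ subarray, each of the $s^t$ ordered $t$-tuples of symbols occurs as a row exactly $\lambda$ times. Two such arrays are disjoint if they have no row in common. For multisets $A=\{\mathbf{a}_1,\ldots,\mathbf{a}_n\}$, $B=\{\mathbf{b}_1,\ldots,\mathbf{b}_n\}\subset\mathbb{Q}^r$, $\mathbf{a}_i=(a_{i1},\ldots,a_{ir})$, $\mathbf{b}_i=(b_{i1},\ldots,b_{ir})$, $(A,B)$ is a $\mathrm{PTE}_r$ solution of degree $m$ and size $n$ if $A,B$ have no common element and $\sum_i\prod_j a_{ij}^{k_j}=\sum_i\prod_j b_{ij}^{k_j}$ for all nonnegative integers $k_j$ with $1\le\sum_jk_j\le m$; it is proper if the $n\times r$ matrices with rows $\mathbf{a}_i$ resp. $\mathbf{b}_i$ both have rank $r$. *)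

(* Defs.v *)
From HB Require Import structures.
From mathcomp Require Export all_boot all_order all_algebra finmap.
Set Implicit Arguments.
Unset Strict Implicit.
Unset Printing Implicit Defensive.
Local Open Scope ring_scope.

(* A is an OA(l, r, s, t)_lambda on the symbol set S.  An l x t subarray is the
   selection of t columns by a strictly increasing f.  The conditions
   1 <= lambda and t <= r are the usual ones: with t > r there is no l x t
   subarray, and with lambda = 0 the array has no rows. *)
Definition orthogonal_array (T : choiceType) (l r s t lambda : nat)
    (S : {fset T}) (A : 'M[T]_(l, r)) : Prop :=
  [/\ #|` S|%fset = s, (0 < lambda)%N, (t <= r)%N,
      forall i j, A i j \in S
    & forall f : 'I_t -> 'I_r, {homo f : j k / (j < k)%N} ->
      forall w : 'rV[T]_t, (forall j, w 0 j \in S) ->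
      #|[set i : 'I_l | row i (colsub f A) == w]| = lambda].

Definition no_common_row (T : Type) (m n r : nat)
    (A : 'M[T]_(m, r)) (B : 'M[T]_(n, r)) : Prop :=
  forall i j, row i A <> row j B.

(* A multiset {a_1, ..., a_n} of points of Q^r is represented by the n x r
   matrix with rows a_1, ..., a_n; the notions below do not depend on the
   order of the rows. *)
Definition PTE_solution (r m n : nat) (A B : 'M[rat]_(n, r)) : Prop :=
  no_common_row A B /\
  forall k : 'I_r -> nat, (1 <= \sum_(j < r) k j <= m)%N ->
    \sum_(i < n) \prod_(j < r) A i j ^+ k j =
    \sum_(i < n) \prod_(j < r) B i j ^+ k j.

Definition proper_PTE_solution (r m n : nat) (A B : 'M[rat]_(n, r)) : Prop :=
  [/\ PTE_solution m A B, \rank A = r & \rank B = r].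

(* Main.v *)
Require Import Defs.
From mathcomp Require Import all_boot all_order all_algebra finmap.
From mathcomp Require Import perm.

Set Implicit Arguments.
Unset Strict Implicit.
Unset Printing Implicit Defensive.

(** Any two orthogonal arrays with the same parameters agree, up to a
    permutation of the rows, on any set of at most [t] columns.  A monomial of
    degree at most [t] involves at most [t] columns, hence has the same sum over
    both arrays.

    For the rank, exchanging two symbols [x], [y] in one column [j] of [X] gives
    again an orthogonal array.  Comparing it with [X] on [j] and one further
    column shows that the rows with [x] in column [j] and those with [y] in
    column [j] are equally many and have the same sum in every other column.  If
    [X v = 0], summing over each of the two families of rows and subtracting
    yields [N (x - y) v_j = 0] with [N > 0]. *)

Import GRing.Theory Num.Theory.
Local Open Scope ring_scope.

Lemma exists_superset_card (T : finType) (J : {set T}) (t : nat) :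
  (#|J| <= t <= #|T|)%N -> exists2 K : {set T}, J \subset K & #|K| = t.
Proof.
move=> /andP[].
elim: t => [|t IHt]; first by rewrite leqn0 => /eqP J0 _; exists J.
rewrite leq_eqVlt => /predU1P[<- _|/IHt IH ltT]; first by exists J.
have [K sJK cK] := IH (ltnW ltT).
have /set0Pn[x]: ~: K != set0.
  by rewrite -card_gt0 -(ltn_add2l #|K|) cardsC addn0 cK.
rewrite inE => xK; exists (x |: K); first exact: subset_trans sJK (subsetUr _ _).
by rewrite cardsU1 xK cK.
Qed.

(** Orthogonal arrays are constrained only on exactly [t] columns taken in increasing order. To use
    this on a smaller set [J], pad it to [t] columns, which needs [t <= r], and list these in
    order. *)
Lemma exists_increasing_cover (r t : nat) (J : {set 'I_r}) :
  (#|J| <= t <= r)%N ->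
  exists2 f : 'I_t -> 'I_r, {homo f : j k / (j < k)%N} &
    forall j, j \in J -> exists u, f u = j.
Proof.
rewrite -[X in (_ <= _ <= X)%N]card_ord.
case/exists_superset_card => K /subsetP sJK cK.
have szK : size (enum K) = t by rewrite -cardE.
have sortedK : sorted ltn (map val (enum K)).
  rewrite /enum_mem -enumT.
  apply: (subseq_sorted ltn_trans _ (iota_ltn_sorted 0 r)).
  by rewrite -val_enum_ord map_subseq // filter_subseq.
exists (fun u => tnth (in_tuple (enum K)) (cast_ord (esym szK) u)).
  (* [x0] is only a default for [nth]; it is built from [u] because ['I_r] could be empty. *)
  move=> u v uv; have x0 := tnth (in_tuple (enum K)) (cast_ord (esym szK) u).
  rewrite !(tnth_nth x0) /= -!(nth_map x0 0%N val) ?szK //.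
  by apply: (sorted_ltn_nth ltn_trans); rewrite ?inE ?size_map ?szK.
move=> j /sJK; rewrite -mem_enum => jK.
have lt_j : (index j (enum K) < t)%N by rewrite -szK index_mem.
by exists (Ordinal lt_j); rewrite (tnth_nth j) /= nth_index.
Qed.

(** The multiplicity of every word, including those with letters outside [S], depends only on the
    parameters; this lets two arrays be compared as multisets of rows. *)
Lemma oa_count (T : choiceType) (l r s t lambda : nat) (S : {fset T})
    (X : 'M[T]_(l, r)) (f : 'I_t -> 'I_r) (w : 'rV[T]_t) :
    orthogonal_array s t lambda S X -> {homo f : j k / (j < k)%N} ->
  #|[set i | row i (colsub f X) == w]| =
    if [forall j, w 0 j \in S] then lambda else 0%N.
Proof.
move=> [_ _ _ XS XOA] fincr; case: ifP => [/forallP|/forallP wS]; first exact: XOA.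
apply/eqP; rewrite cards_eq0; apply/set0Pn => -[i]; rewrite inE => /eqP eqw.
by apply: wS => j; rewrite -eqw !mxE.
Qed.

Lemma oa_perm (T : choiceType) (l r s t lambda : nat) (S : {fset T})
    (X Y : 'M[T]_(l, r)) (J : {set 'I_r}) :
    orthogonal_array s t lambda S X -> orthogonal_array s t lambda S Y ->
    (#|J| <= t)%N ->
  exists p : 'S_l, forall i j, j \in J -> X i j = Y (p i) j.
Proof.
move=> XOA YOA leJ; have [_ _ le_tr _ _] := XOA.
have [|f fincr fJ] := @exists_increasing_cover r t J; first by rewrite leJ.
pose rows (Z : 'M[T]_(l, r)) := [tuple row i (colsub f Z) | i < l].
have countE Z w : count_mem w (rows Z) = #|[set i | row i (colsub f Z) == w]|.
  by rewrite /= count_map enumT -size_filter cardsE cardE.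
have : perm_eq (rows X) (rows Y).
  by apply/allP => w _; rewrite /= !countE (oa_count w XOA) ?(oa_count w YOA).
case/tuple_permP => p /val_inj eqp; exists p => i j /fJ[u <-].
have := congr1 (fun z => tnth z i) eqp; rewrite !tnth_mktuple.
by move/rowP/(_ u); rewrite !mxE.
Qed.

Lemma oa_relabel (T : choiceType) (l r s t lambda : nat) (S : {fset T})
    (X : 'M[T]_(l, r)) (h : 'I_r -> T -> T) :
    (forall j, involutive (h j)) -> (forall j x, x \in S -> h j x \in S) ->
    orthogonal_array s t lambda S X ->
  orthogonal_array s t lambda S (\matrix_(i, j) h j (X i j)).
Proof.
move=> hK hS [cS lam0 le_tr XS XOA]; split=> // [i j|f fincr w wS].
  by rewrite mxE hS.
(* As each [h j] is an involution, [w] occurs in the relabelled array exactly in those rows where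
   its relabelling occurs in [X]. *)
rewrite -(XOA f fincr (\row_u h (f u) (w 0 u))) => [|u]; last by rewrite mxE hS.
apply: eq_card => i; rewrite !inE; apply/eqP/eqP => /rowP eqw; apply/rowP => u.
  by rewrite !mxE -eqw !mxE hK.
by have := eqw u; rewrite !mxE => ->; rewrite hK.
Qed.

Lemma oa_swap_perm (T : choiceType) (l r s t lambda : nat) (S : {fset T})
    (X : 'M[T]_(l, r)) (j k : 'I_r) (x y : T) :
    orthogonal_array s t lambda S X -> (2 <= t)%N -> x \in S -> y \in S ->
  exists p : 'S_l,
    (forall i, (X i j == x) = (X (p i) j == y)) /\
    (k != j -> forall i, X i k = X (p i) k).
Proof.
move=> XOA t2 xS yS.
pose sw z := if z == x then y else if z == y then x else z.
have swK : involutive sw.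
  move=> z; rewrite /sw; have [->|zx] := eqVneq z x.
    by rewrite eqxx; case: eqVneq.
  by have [->|zy] := eqVneq z y; rewrite ?eqxx // (negPf zx) (negPf zy).
pose h (m : 'I_r) := if m == j then sw else id.
have hOA : orthogonal_array s t lambda S (\matrix_(i, m) h m (X i m)).
  apply: oa_relabel => // [m|m z zS]; rewrite /h; case: ifP => // _.
  by rewrite /sw; case: ifP => // _; case: ifP.
(* At most two columns are compared, hence the bound [2 <= t]. The swap acts in column [j] alone, so
   column [k] is only permuted when [k != j]. *)
have [|p Xp] := @oa_perm _ _ _ _ _ _ _ _ _ [set j; k] XOA hOA.
  by rewrite cards2; case: (j != k) => //; apply: ltnW.
exists p; split=> [i|kj i].
  rewrite Xp ?set21 // mxE /h eqxx; apply/eqP/eqP => [|->].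
    by move/(congr1 sw); rewrite swK /sw eqxx.
  by rewrite /sw eqxx; case: eqVneq.
by rewrite Xp ?set22 // mxE /h (negPf kj).
Qed.

Lemma oa_symbol_occurs (T : choiceType) (l r s t lambda : nat) (S : {fset T})
    (X : 'M[T]_(l, r)) (j : 'I_r) (x : T) :
    orthogonal_array s t lambda S X -> (0 < t)%N -> x \in S ->
  exists i, X i j = x.
Proof.
move=> [_ lam0 le_tr _ XOA] t0 xS.
have [|f fincr fJ] := @exists_increasing_cover r t [set j].
  by rewrite cards1 t0.
have [u fu] := fJ j (set11 j).
(* Any word over [S] with [x] at position [u] would do; the constant one occurs [lambda > 0]
   times. *)
have : (0 < #|[set i | row i (colsub f X) == const_mx x]|)%N.
  by rewrite XOA // => m; rewrite mxE.
case/card_gt0P => i; rewrite inE => /eqP/rowP/(_ u); rewrite !mxE fu => <-.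
by exists i.
Qed.

Lemma oa_monomial_sum (R : comNzRingType) (l r s t lambda : nat) (S : {fset R})
    (X Y : 'M[R]_(l, r)) (k : 'I_r -> nat) :
    orthogonal_array s t lambda S X -> orthogonal_array s t lambda S Y ->
    (\sum_j k j <= t)%N ->
  \sum_i \prod_j X i j ^+ k j = \sum_i \prod_j Y i j ^+ k j.
Proof.
move=> XOA YOA le_kt.
(* Each column of the support of [k] contributes at least 1 to the degree, so the support has at
   most [t] columns. *)
have [|p Xp] := @oa_perm _ _ _ _ _ _ _ _ _ [set j | (0 < k j)%N] XOA YOA.
  apply: leq_trans le_kt; rewrite -sum1_card big_mkcond leq_sum // => j _.
  by rewrite inE; case: ifP.
rewrite [RHS](reindex_inj (@perm_inj _ p)); apply: eq_bigr => i _.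
apply: eq_bigr => j _; case: (posnP (k j)) => [->|kj]; first by rewrite !expr0.
by rewrite Xp // inE.
Qed.

Lemma oa_rank (F : numFieldType) (l r s t lambda : nat) (S : {fset F})
    (X : 'M[F]_(l, r)) :
    (2 <= s)%N -> (2 <= t)%N -> orthogonal_array s t lambda S X -> \rank X = r.
Proof.
move=> s2 t2 XOA; rewrite -mxrank_tr; apply/eqP/inj_row_free => v vX.
have Xv i : \sum_k v 0 k * X i k = 0.
  move/rowP/(_ i): vX; rewrite !mxE => vXi.
  by rewrite -[RHS]vXi; apply: eq_bigr => k _; rewrite mxE.
have [x xS [y yS xy]] : exists2 x, x \in S & exists2 y, y \in S & x != y.
  have [cS _ _ _ _] := XOA; rewrite -cS in s2.
  have /fset0Pn[x xS] : S != fset0 by rewrite -cardfs_gt0 ltnW.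
  have /fset0Pn[y] : (S `\ x)%fset != fset0.
    by rewrite -cardfs_gt0; move: s2; rewrite (cardfsD1 x) xS.
  by rewrite !inE eq_sym => /andP[xy yS]; exists x => //; exists y.
apply/rowP => j; rewrite mxE; apply/eqP.
(* [N z] counts the rows with [z] in column [j], and [M z k] is the sum of column [k] over them. *)
pose N z := #|[set i | X i j == z]|.
pose M z k := \sum_(i | X i j == z) X i k.
have NE z : M z j = (N z)%:R * z.
  rewrite /M (eq_bigr (fun=> z)) => [|i /eqP//].
  by rewrite sumr_const mulr_natl /N cardsE.
have Mxy k : k != j -> M x k = M y k.
  move=> kj; have [p [pj /(_ kj) pk]] := oa_swap_perm j k XOA t2 xS yS.
  rewrite /M [RHS](reindex_inj (@perm_inj _ p)).
  by apply: eq_big => [i|i _]; [apply: pj | apply: pk].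
have Nxy : N x = N y.
  (* With [k = j] only the matching of the two families of rows is wanted. *)
  have [p [pj _]] := oa_swap_perm j j XOA t2 xS yS.
  rewrite /N -[RHS](card_preimset _ (@perm_inj _ p)).
  by apply: eq_card => i; rewrite !inE pj.
have vM z : \sum_k v 0 k * M z k = 0.
  under eq_bigr do rewrite mulr_sumr.
  by rewrite exchange_big big1 // => i _; apply: Xv.
have : \sum_k v 0 k * (M x k - M y k) = 0.
  by under eq_bigr do rewrite mulrBr; rewrite sumrB !vM subrr.
(* Only column [j] survives the subtraction, leaving the product of [v 0 j], [N x] and [x - y]. *)
rewrite (bigD1 j) //= big1 => [|k kj]; last by rewrite Mxy // subrr mulr0.
rewrite addr0 !NE -Nxy -mulrBr => /eqP; rewrite !mulf_eq0 subr_eq0 (negPf xy).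
rewrite orbF pnatr_eq0 cards_eq0 => /orP[//|/set0Pn[]].
have [i Xi] := oa_symbol_occurs j XOA (ltnW t2) xS.
by exists i; rewrite inE Xi.
Qed.

Local Close Scope ring_scope.

Theorem theorem4p1 (l r s t lambda : nat) (S : {fset rat})
    (X Y : 'M[rat]_(l, r)) (hs : 2 <= s) (ht : 2 <= t)
    (hX : orthogonal_array s t lambda S X)
    (hY : orthogonal_array s t lambda S Y)
    (hXY : no_common_row X Y) :
  proper_PTE_solution t X Y.
Proof.
split; [split=> // k /andP[_ le_kt] | exact: oa_rank hX | exact: oa_rank hY].
exact: oa_monomial_sum hX hY le_kt.
Qed.
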